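(* Let $L,R:[0,\infty)\times\mathbb{R}\to\mathbb{R}$ satisfy: (i) for each $x\in\mathbb{R}$, $L(\cdot,x),R(\cdot,x)\in D[0,\infty)$; (ii) for each $t\ge 0$, $L(t,\cdot)$ and $R(t,\cdot)$ are strictly increasing; (iii) there are constants $0<c<C<\infty$ such that $c|x-y|\le |L(t,x)-L(t,y)|\le C|x-y|$ and $c|x-y|\le |R(t,x)-R(t,y)|\le C|x-y|$ for all $t\ge 0$, $x,y\in\mathbb{R}$; (iv) $\inf_{(t,x)\in[0,\infty)\times\mathbb{R}}(R(t,x)-L(t,x))>0$. Let $c^1_0,c^2_0\in\mathbb{R}$ and $S^1,S^2\in D[0,\infty)$ with $S^1_0=S^2_0=0$, and suppose there is a nonnegative $\nu\in I[0,\infty)$ such that $S^2_t\le S^1_t\le S^2_t+\nu_t$ for all $t\ge0$. For $i=1,2$, let $(X^i,K^i)$ be the solution of $\mathbb{SP}_L^R(c_0^i+S^i)$. Then for all $t\ge 0$: 1. $K_t^1-(c^2_0-c^1_0)^+\le K^2_t\le K^1_t+\nu_t+(c_0^1-c_0^2)^+$; 2. $X_t^2-\nu_t-(c^2_0-c^1_0)^+\le X^1_t\le X^2_t+\nu_t+(c_0^1-c_0^2)^+$.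
   Context: $D[0,\infty)$ is the set of real-valued right-continuous functions on $[0,\infty)$ with left limits; $I[0,\infty)$ is the subset of nondecreasing functions; $BV[0,\infty)$ is the set of $K\in D[0,\infty)$ of bounded variation on each compact interval. Notation: $a^+=\max(a,0)$. Skorokhod problem $\mathbb{SP}_L^R(S)$: a pair $(X,K)\in D[0,\infty)\times BV[0,\infty)$ is a solution if (a) $X_t=S_t+K_t$ for all $t\ge0$; (b) $L(t,X_t)\le 0\le R(t,X_t)$ for all $t\ge 0$; (c) $K_{0-}=0$ and $K=K^r-K^l$, where $K^r,K^l$ are nondecreasing (right-continuous, with $K^r_{0-}=K^l_{0-}=0$) and $\int_0^\infty I_{\{L(s,X_s)<0\}}dK^l_s=0$, $\int_0^\infty I_{\{R(s,X_s)>0\}}dK^r_s=0$. The integrals are over $[0,\infty)$ including time $0$, where $dK^r,dK^l$ have atoms of mass $K^r_0,K^l_0$. Under the hypotheses (i)–(iv) on $L,R$, this problem has a unique solution for every $S\in D[0,\infty)$. *)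

(* Defs.v *)
From HB Require Import structures.
From mathcomp Require Import all_boot all_order all_algebra.
From mathcomp Require Import all_classical all_reals all_analysis.

Set Implicit Arguments.
Unset Strict Implicit.
Unset Printing Implicit Defensive.

Import Order.TTheory GRing.Theory Num.Theory.
Import numFieldNormedType.Exports.

Local Open Scope classical_set_scope.
Local Open Scope ring_scope.

(* A function on [0, +oo[ is represented by a total function on the real line
   whose values at negative times are never used. *)

Definition cadlag {R : realType} (f : R -> R) : Prop :=
  (forall t, 0 <= t -> f x @[x --> t^'+] --> f t) /\
  (forall t, 0 < t -> cvg (f x @[x --> t^'-])).

Definition cadlag_nondecreasing {R : realType} (f : R -> R) : Prop :=
  cadlag f /\ {in `[0, +oo[ &, nondecreasing f}.

Definition cadlag_BV {R : realType} (f : R -> R) : Prop :=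
  cadlag f /\ forall t, 0 <= t -> bounded_variation 0 t f.

(* A nondecreasing right-continuous k on [0, +oo[ with k_{0-} = 0 is encoded by
   its extension by 0 to negative times, which is a cumulative function on the
   real line.  Its Lebesgue-Stieltjes measure then has the atom k 0 at time 0,
   and the integrals below run over [0, +oo[, time 0 included. *)
Definition skorokhod_solution {R : realType} (L U : R -> R -> R) (S X K : R -> R)
    : Prop :=
  [/\ cadlag X, cadlag_BV K,
      (forall t, 0 <= t -> X t = S t + K t),
      (forall t, 0 <= t -> L t (X t) <= 0 <= U t (X t)) &
      exists kr kl : cumulative R R,
        [/\ (forall t, t < 0 -> kr t = 0 /\ kl t = 0),
            (forall t, 0 <= t -> K t = kr t - kl t),
            (\int[lebesgue_stieltjes_measure kl]_(s in `[0%R, +oo[)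
               (\1_[set s | L s (X s) < 0] s)%:E = 0)%E &
            (\int[lebesgue_stieltjes_measure kr]_(s in `[0%R, +oo[)
               (\1_[set s | U s (X s) > 0] s)%:E = 0)%E]].

(* U is the function usually written R, a letter kept here for the field of
   reals.  The infimum is taken in the extended reals: inf would be 0 on a set
   that is not bounded below. *)
Definition barrier_pair {R : realType} (L U : R -> R -> R) : Prop :=
  [/\ (forall x, cadlag (L^~ x) /\ cadlag (U^~ x)),
      (forall t, 0 <= t ->
         {homo L t : x y / x < y} /\ {homo U t : x y / x < y}),
      (exists c C : R, [/\ 0 < c, c < C &
         forall t x y, 0 <= t ->
           c * `|x - y| <= `|L t x - L t y| <= C * `|x - y| /\
           c * `|x - y| <= `|U t x - U t y| <= C * `|x - y|]) &
      (0 < ereal_inf [set (U p.1 p.2 - L p.1 p.2)%:E |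
                        p in [set p : R * R | (0 <= p.1)%R]])%E].

(* Main.v *)
(* Put D = K2 - K1 - w, where w is nondecreasing, nonnegative and dominates
   the difference of the inputs.  On {D > 0} the path X2 lies strictly above
   X1, which keeps X2 off the lower barrier and X1 off the upper one, so the
   measures that could increase D do not charge {D > 0}.  Let s be the supremum
   of the times before t at which D <= 0: D cannot have become positive after
   s, nor by a jump at s, so D <= 0 throughout.  Both bounds on K2 are instances
   of this comparison, and those on X1 follow from X = S + K. *)
Require Import Defs.
From HB Require Import structures.
From mathcomp Require Import all_boot all_order all_algebra.
From mathcomp Require Import all_classical all_reals all_analysis.
From mathcomp Require Import lra measurable_realfun.

Set Implicit Arguments.
Unset Strict Implicit.
Unset Printing Implicit Defensive.

Import Order.TTheory GRing.Theory Num.Theory.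
Import numFieldNormedType.Exports.

Local Open Scope classical_set_scope.
Local Open Scope ring_scope.

(** The indicator of [I] is a simple function below the integrand, so its integral [mu I] is at most
    the integral over [D]. Here [A] will be a set where a path is off a barrier, and [I] an interval
    inside it. *)
Lemma measure0_of_integral_indic0 (R : realType) (d : measure_display)
    (T : measurableType d) (mu : {measure set T -> \bar R}) (D A I : set T) :
  (\int[mu]_(x in D) (\1_A x)%:E = 0)%E ->
  measurable I -> I `<=` D `&` A -> mu I = 0%E.
Proof.
move=> intA mI IDA; apply/eqP; rewrite eq_le measure_ge0 andbT -intA.
(* [ge0_le_integral] would ask for [A] to be measurable, hence the direct use of
   the supremum over simple functions. *)
rewrite ge0_integralE => [|x _]; last by rewrite lee_fin indicE ler0n.
apply: ereal_sup_ubound; exists (indic_nnsfun R mI); last first.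
  exact: sintegral_indic.
move=> x /=; rewrite /mindic patchE !indicE.
have [/set_mem/IDA[Dx Ax]|_] := boolP (x \in I); first by rewrite !mem_set.
by case: ifP; rewrite lee_fin.
Qed.

Lemma lebesgue_stieltjes_itvoc (R : realType) (f : cumulative R R) (a b : R) :
  a <= b -> lebesgue_stieltjes_measure f `]a, b]%classic = (f b - f a)%:E.
Proof.
move=> ab; rewrite /lebesgue_stieltjes_measure /measure_extension/=.
by rewrite measurable_mu_extE/= ?wlength_itv_bnd//; exact: is_ocitv.
Qed.

(** Continuity from above along the intervals [F n]: the mass of [[s, t]] is [f t] minus the left
    limit of [f] at [s]. That this vanishes is stated with [e], without left limits. *)
Lemma lebesgue_stieltjes_itvcc0 (R : realType) (f : cumulative R R)
    (s t e : R) : s <= t -> 0 < e ->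
  lebesgue_stieltjes_measure f `[s, t]%classic = 0%E ->
  exists2 u, u < s & forall v, u < v -> f t - f v < e.
Proof.
move=> st e0 mu0.
pose F n : set (measurableTypeR R) := `]s - n.+1%:R^-1, t]%classic.
have le_t n : s - n.+1%:R^-1 <= t by rewrite (le_trans _ st)// gerBl invr_ge0.
have capF : \bigcap_n F n = `[s, t]%classic.
  apply/seteqP; split => [x Fx|x].
    rewrite /= in_itv/=; apply/andP; split; last first.
      by have := Fx 0%N I; rewrite /F/= in_itv/= => /andP[].
    apply/ler_addgt0Pr => _/posnumP[r].
    have [N _ /(_ N (leqnn N)) Nr] := near_infty_natSinv_lt r.
    have := Fx N I; rewrite /F/= in_itv/= => /andP[+ _].
    by rewrite ltrBlDr => /ltW/le_trans; apply; rewrite lerD2l ltW.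
  rewrite /= in_itv/= => /andP[sx xt] n _.
  by rewrite /F/= in_itv/= xt andbT (lt_le_trans _ sx)// gtrBl invr_gt0.
have mF n : measurable (F n) by exact: measurable_itv.
have : lebesgue_stieltjes_measure f \o F @ \oo --> 0%E.
  rewrite -mu0 -capF; apply: nonincreasing_cvg_mu => //.
  - have := ltry (f t - f (s - 1%:R^-1)).
    by rewrite -(lebesgue_stieltjes_itvoc f (le_t 0%N)).
  - by rewrite capF; exact: measurable_itv.
  - move=> m n mn; apply/subsetPset; apply: subset_itv; rewrite ?lexx//.
    by rewrite bnd_simp lerB// lef_pV2 ?posrE// ler_nat.
move=> /fine_cvgP[_] /(@cvgrPdist_lt _ R^o)/(_ _ e0)[N _ /(_ N (leqnn N))] /=.
rewrite [X in fine X](lebesgue_stieltjes_itvoc f (le_t N)) /=.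
rewrite sub0r normrN => fe.
exists (s - N.+1%:R^-1); first by rewrite gtrBl invr_gt0.
move=> v /ltW /(cumulative_is_nondecreasing f) fv.
by apply: le_lt_trans fe; rewrite (le_trans _ (ler_norm _))// lerB.
Qed.

(* To be applied with [f1 + f2] the increasing part of [D] and [w] the
   decreasing one; the values at negative times account for the atoms at 0. *)
Lemma cumulative_addr_le (R : realType) (f1 f2 : cumulative R R)
    (w : R -> R) (A1 A2 : set R) :
  {homo w : x y / x <= y} ->
  (forall t, t < 0 -> f1 t + f2 t <= w t) ->
  (\int[lebesgue_stieltjes_measure f1]_(s in `[0%R, +oo[)
    (\1_A1 s)%:E = 0)%E ->
  (\int[lebesgue_stieltjes_measure f2]_(s in `[0%R, +oo[)
    (\1_A2 s)%:E = 0)%E ->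
  (forall t, 0 <= t -> w t < f1 t + f2 t -> A1 t /\ A2 t) ->
  forall t, f1 t + f2 t <= w t.
Proof.
move=> w_nd neg null1 null2 wA t; rewrite leNgt; apply/negP => wf.
have t0 : 0 <= t by rewrite leNgt; apply: contraTN wf => /neg; rewrite leNgt.
(* Negative times belong to [E]: they make it nonempty and force [0 <= sup E]. *)
pose E := [set u | u <= t /\ f1 u + f2 u <= w u].
have negE u : u < 0 -> E u.
  by move=> u0; split; [rewrite (le_trans (ltW u0))|exact: neg].
have supE : has_sup E.
  by split; [exists (- 1); apply: negE; rewrite ltrN10|exists t => u []].
have ubE u : E u -> u <= sup E by move=> Eu; exact: sup_upper_bound.
have st : sup E <= t by apply: ge_sup; [case: supE|move=> u []].
have s0 : 0 <= sup E.
  rewrite leNgt; apply/negP => s0; have /ubE : E (sup E / 2).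
    by apply: negE; lra.
  by lra.
have after_s x : ~ E x -> x <= t -> w x < f1 x + f2 x.
  by move=> nEx xt; rewrite ltNge; apply/negP => fw; exact: nEx.
(* Points of [[sup E, t]] outside [E] are nonnegative times with [w < f1 + f2], so they lie in both
   null sets. *)
have sA (I : set R) : I `<=` `[sup E, t]%classic -> (forall x, I x -> ~ E x) ->
    forall x, I x -> [/\ `[0, +oo[%classic x, A1 x & A2 x].
  move=> Ist InE x Ix; have := Ist x Ix; rewrite /= in_itv/= => /andP[sx xt].
  have x0 := le_trans s0 sx.
  have [A1x A2x] := wA x x0 (after_s x (InE x Ix) xt).
  by split => //=; rewrite in_itv/= x0.
(* If [D (sup E) > 0], then [sup E] is itself charged by neither measure, which
   rules out a jump there. *)
have [Es|nEs] := pselect (E (sup E)).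
  (* [f1] and [f2] are constant from [sup E] to [t] while [w] does not decrease, so the inequality
     at [sup E] persists at [t]. *)
  have soc x : `]sup E, t]%classic x ->
      [/\ `[0, +oo[%classic x, A1 x & A2 x].
    apply: sA => [y|y]; rewrite /= !in_itv/= => /andP[sy yt].
      by rewrite ltW.
    by move=> /ubE; rewrite leNgt sy.
  have eq_f (f : cumulative R R) :
      lebesgue_stieltjes_measure f `]sup E, t]%classic = 0%E ->
      f t = f (sup E).
    by rewrite lebesgue_stieltjes_itvoc// => -[] /eqP; rewrite subr_eq0 => /eqP.
  have f1s : f1 t = f1 (sup E).
    apply: eq_f; apply: (measure0_of_integral_indic0 null1).
      exact: measurable_itv.
    by move=> x /soc[].
  have f2s : f2 t = f2 (sup E).
    apply: eq_f; apply: (measure0_of_integral_indic0 null2).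
      exact: measurable_itv.
    by move=> x /soc[].
  by case: Es => _ fws; have := w_nd _ _ st; lra.
have scc x : `[sup E, t]%classic x -> [/\ `[0, +oo[%classic x, A1 x & A2 x].
  apply: sA => [//|y]; rewrite /= in_itv/= => /andP[sy _] Ey.
  by apply: nEs; rewrite (_ : sup E = y)//; apply/eqP; rewrite eq_le sy ubE.
(* Half of the excess at [t] for each of [f1] and [f2]: just to the left of [sup E] their sum still
   exceeds [w t]. *)
have e0 : 0 < (f1 t + f2 t - w t) / 2 by lra.
have [u1 u1s fu1] := lebesgue_stieltjes_itvcc0 st e0
  (measure0_of_integral_indic0 null1 (measurable_itv _)
    (fun x h => let: And3 a b _ := scc x h in conj a b)).
have [u2 u2s fu2] := lebesgue_stieltjes_itvcc0 st e0
  (measure0_of_integral_indic0 null2 (measurable_itv _)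
    (fun x h => let: And3 a _ b := scc x h in conj a b)).
(* With this radius, a point [v] of [E] lies beyond both [u1] and [u2], where
   [f1 v + f2 v > w t >= w v]. *)
have d0 : 0 < sup E - Num.max u1 u2 by rewrite subr_gt0 gt_max u1s.
have [v [vt fwv]] := sup_adherent d0 supE.
rewrite subKr gt_max => /andP[/fu1 + /fu2].
by have := w_nd _ _ vt; lra.
Qed.

(** The difference [K2 - K1 - w] is [kr2 + kl1] minus [kr1 + kl2 + w]. Where it is positive,
    [X1 < X2], hence [U s (X2 s) > 0] and [L s (X1 s) < 0]. *)
Lemma skorokhod_solution_K_le (R : realType) (L U : R -> R -> R)
    (S1 S2 X1 K1 X2 K2 w : R -> R) :
  (forall t, 0 <= t ->
     {homo L t : x y / x < y} /\ {homo U t : x y / x < y}) ->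
  skorokhod_solution L U S1 X1 K1 -> skorokhod_solution L U S2 X2 K2 ->
  {in `[0, +oo[ &, nondecreasing w} -> (forall t, 0 <= t -> 0 <= w t) ->
  (forall t, 0 <= t -> S1 t <= S2 t + w t) ->
  forall t, 0 <= t -> K2 t <= K1 t + w t.
Proof.
move=> LU_incr [_ _ X1E LU1 [kr1 [kl1 [k1_neg K1E null1 _]]]].
move=> [_ _ X2E LU2 [kr2 [kl2 [k2_neg K2E _ null2]]]] w_nd w_ge0 S12.
(* Nothing is known of [w] at negative times, so it is replaced by 0 there; [0 <= w] keeps the
   result monotone. *)
pose v t := kr1 t + kl2 t + (if t < 0 then 0 else w t).
suff le_v t : kr2 t + kl1 t <= v t.
  move=> t t0; have := le_v t; rewrite /v ltNge t0/= K1E// K2E//; lra.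
apply: (cumulative_addr_le _ _ null2 null1) => [x y xy|s s0|s s0].
- rewrite /v lerD ?lerD ?cumulative_is_nondecreasing//.
  have [x0|x0] := ltP x 0; have [y0|y0] := ltP y 0 => //.
  + exact: w_ge0.
  + by have := le_lt_trans x0 (le_lt_trans xy y0); rewrite ltxx.
  + by apply: w_nd => //; rewrite in_itv/= ?x0 ?y0.
- have [kr1s kl1s] := k1_neg s s0; have [kr2s kl2s] := k2_neg s s0.
  by rewrite /v s0 kr1s kl1s kr2s kl2s !addr0.
- rewrite /v (le_gtF s0) => vk.
  have X12 : X1 s < X2 s.
    by rewrite X1E// X2E// K1E// K2E//; have := S12 s s0; lra.
  have [L_incr U_incr] := LU_incr s s0.
  have /andP[_ U1] := LU1 s s0; have /andP[L2 _] := LU2 s s0.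
  split => /=.
  + exact: le_lt_trans U1 (U_incr _ _ X12).
  + exact: lt_le_trans (L_incr _ _ X12) L2.
Qed.

Theorem proposition3p4 (R : realType) (L U : R -> R -> R)
    (LU : barrier_pair L U)
    (c1 c2 : R) (S1 S2 : R -> R)
    (S1_cadlag : cadlag S1) (S2_cadlag : cadlag S2)
    (S1_0 : S1 0 = 0) (S2_0 : S2 0 = 0)
    (nu : R -> R) (nu_nd : cadlag_nondecreasing nu)
    (nu_ge0 : forall t, 0 <= t -> 0 <= nu t)
    (S12 : forall t, 0 <= t -> S2 t <= S1 t <= S2 t + nu t)
    (X1 K1 X2 K2 : R -> R)
    (sol1 : skorokhod_solution L U (fun t => c1 + S1 t) X1 K1)
    (sol2 : skorokhod_solution L U (fun t => c2 + S2 t) X2 K2)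
    (t : R) (t_ge0 : 0 <= t) :
  (K1 t - Num.max (c2 - c1) 0 <= K2 t
     <= K1 t + nu t + Num.max (c1 - c2) 0) /\
  (X2 t - nu t - Num.max (c2 - c1) 0 <= X1 t
     <= X2 t + nu t + Num.max (c1 - c2) 0).
Proof.
have [_ LU_incr _ _] := LU; have [_ nu_incr] := nu_nd.
have max_ge0 (x : R) : 0 <= Num.max x 0 by rewrite le_max lexx orbT.
have max_ge (x : R) : x <= Num.max x 0 by rewrite le_max lexx.
have K21 : K2 t <= K1 t + (nu t + Num.max (c1 - c2) 0).
  apply: (skorokhod_solution_K_le LU_incr sol1 sol2
    (w := fun s => nu s + Num.max (c1 - c2) 0)) => // [x y x0 y0 xy|s s0|s s0].
  - by rewrite lerD2r nu_incr.
  - by rewrite addr_ge0 ?nu_ge0.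
  - by have := S12 s s0; have := max_ge (c1 - c2); lra.
(* With the roles exchanged, [S2 <= S1] allows a constant [w]. *)
have K12 : K1 t <= K2 t + Num.max (c2 - c1) 0.
  apply: (skorokhod_solution_K_le LU_incr sol2 sol1
    (w := fun=> Num.max (c2 - c1) 0)) => // s s0.
  by have := S12 s s0; have := max_ge (c2 - c1); lra.
(* The identity of positive parts that converts the bounds on [K1 - K2] into those on [X1 - X2]. *)
have maxB : Num.max (c1 - c2) 0 - Num.max (c2 - c1) 0 = c1 - c2.
  by rewrite /Num.max; case: ltP => ?; case: ltP => ?; lra.
have [_ _ X1E _ _] := sol1; have [_ _ X2E _ _] := sol2.
have := S12 t t_ge0; rewrite X1E// X2E//.
by split; lra.
Qed.
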